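(* Let $n\ge 1$ and let $G$ be a bipartite graph with $\binom{n+1}{2}$ edges. Let $d_1\le d_2\le\cdots\le d_k$ be the degree sequence of the vertices of one of the stable sets (colour classes) of $G$. If $$d_{k-i}\ge n-i\quad\text{for each } 0\le i\le k-1,$$ then $G$ admits a star-forest ascending subgraph decomposition.
   Context: All graphs are finite and simple. A star forest is a forest each of whose connected components is a star. A graph $G$ with $\binom{n+1}{2}$ edges has an ascending subgraph decomposition (ASD) if its edge set can be partitioned as $G=G_1\oplus\cdots\oplus G_n$ (edge-disjoint union) where $G_i$ has exactly $i$ edges and $G_i$ is isomorphic to a subgraph of $G_{i+1}$ for $1\le i<n$. A star-forest ASD is an ASD in which every $G_i$ is a star forest. *)

(* Defs.v *)
From mathcomp Require Import all_boot.

Set Implicit Arguments.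
Unset Strict Implicit.
Unset Printing Implicit Defensive.

Record sgraph (T : finType) := SGraph {
  adj :> rel T;
  adj_sym : symmetric adj;
  adj_irrefl : irreflexive adj }.

Section Graphs.
Variable T : finType.
Implicit Types (G H K : sgraph T) (S A B C : {set T}).

Definition edges G : {set {set T}} :=
  [set [set p.1; p.2] | p : T * T & adj G p.1 p.2].

Definition degree G (x : T) : nat := #|[set y | adj G x y]|.

Definition stable G S : Prop := {in S &, forall x y, ~~ adj G x y}.

Definition colour_classes G A B : Prop :=
  [/\ A :|: B = [set: T], [disjoint A & B], stable G A & stable G B].

(* Nondecreasing and indexed from 0: the entry written d_j when the sequence
   is indexed from 1 is [nth 0 (degree_seq G S) j.-1]. *)
Definition degree_seq G S : seq nat :=
  sort leq [seq degree G x | x <- enum S].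

Definition component G (x : T) : {set T} := [set y | connect (adj G) x y].

Definition forest G : Prop :=
  forall c : seq T, 2 < size c -> ~ ucycle (adj G) c.

(* The graph induced on C is a K_{1,m}; m = 0, an isolated vertex, is
   allowed. *)
Definition star_on G C : Prop :=
  exists2 c, c \in C &
    {in C &, forall x y, adj G x y = (x != y) && ((x == c) || (y == c))}.

Definition star_forest G : Prop :=
  forest G /\ forall x, star_on G (component G x).

(* The parts of a decomposition are determined by their edges, so they are all
   taken to be spanning, on the common vertex set T.  Padding both graphs with
   isolated vertices up to T does not affect whether one of them is isomorphic
   to a subgraph of the other: an injection between two subsets of T extends to
   a permutation of T. *)
Definition subgraph H K : Prop := forall x y, adj H x y -> adj K x y.

Definition isomorphic H K : Prop :=
  exists2 f : T -> T, bijective f & forall x y, adj K (f x) (f y) = adj H x y.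

(* Only the graphs F 1, ..., F n matter. *)
Definition ASD G (n : nat) (F : nat -> sgraph T) : Prop :=
  [/\ \bigcup_(1 <= i < n.+1) edges (F i) = edges G,
      forall i j, 1 <= i <= n -> 1 <= j <= n -> i != j ->
        [disjoint edges (F i) & edges (F j)],
      forall i, 1 <= i <= n -> #|edges (F i)| = i
    & forall i, 1 <= i < n ->
        exists2 K, subgraph K (F i.+1) & isomorphic (F i) K].

Definition star_forest_ASD G (n : nat) (F : nat -> sgraph T) : Prop :=
  ASD G n F /\ forall i, 1 <= i <= n -> star_forest (F i).

End Graphs.

(* Main.v *)
(* Let the k = min(|A|, n) largest degrees in A be d_0 >= d_1 >= ..., put
   e = n - k, and write d_j = (n - j) + x_j; the excesses x_j sum to
   C(e+1, 2).  The excesses are split as x = f_1 + ... + f_e, where f_l has sum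
   l and is dominated by a permutation of f_(l+1).  The part G_i gets, at the
   j-th vertex of A, one edge if j < i and f_(i-k)(j) further edges if i > k.
   The parts are peeled off from i = n down to 1.  The last vertices of A (from
   j on) need at most i - j edges of G_i in total, and the j-th vertex still has
   at least i - j edges, so leaves can be chosen greedily, distinct at the
   B-end.

   For the splitting of x, f_l is a permuted hook: one entry l - m l, and m l
   entries 1.  Going down from l = e, the hook, sorted, is subtracted from x,
   sorted; this preserves the majorization of x by the sum L of the remaining
   sorted hooks.  The largest entry of x must be at least the arm l - m l.  This
   holds as soon as some t rows of x have the same sum as the first t entries of
   L, a property that also persists; it is reached by shifting cells of the hooks
   from the arm to the legs until majorization becomes tight. *)

Require Import Defs.
From mathcomp Require Import all_boot.
From mathcomp Require Import fingroup perm zify.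

Set Implicit Arguments.
Unset Strict Implicit.
Unset Printing Implicit Defensive.

(** * Sums over initial segments and thresholds of nonincreasing sequences *)

Lemma leq_sum_ord s t (g : nat -> nat) :
  s <= t -> \sum_(q < s) g q <= \sum_(q < t) g q.
Proof.
move=> /subnKC <-; rewrite big_split_ord /=; exact: leq_addr.
Qed.

Lemma sum_ltn_ord Q n : n <= Q -> \sum_(q < Q) (q < n : nat) = n.
Proof.
elim: Q n => [|Q IH] n; first by rewrite big_ord0; lia.
rewrite leq_eqVlt big_ord_recr /= => /orP[/eqP ->|nQ].
  rewrite (eq_bigr (fun=> 1)); last by move=> q _; have := ltn_ord q; lia.
  by rewrite sum_nat_const card_ord; lia.
by rewrite IH; lia.
Qed.

Lemma nonincreasing_threshold (y : nat -> nat) Q w :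
  {homo y : p q / p <= q >-> q <= p} ->
  exists2 n, n <= Q & forall q, q < Q -> (w < y q) = (q < n).
Proof.
move=> y_dec; elim: Q => [|Q [n nQ IH]]; first by exists 0.
case: (ltnP w (y Q)) => wy.
  exists Q.+1 => // q qQ; have := y_dec q Q; lia.
exists n => [|q]; first lia.
rewrite ltnS leq_eqVlt => /orP[/eqP ->|/IH//]; lia.
Qed.

(** * Chains of hooks and the sums of their slots *)

(* Slot 0 is the arm of a hook of size [i], slots 1, ..., [m i] are its legs. *)
Definition hook (m : nat -> nat) i q := if q is 0 then i - m i else q <= m i : nat.

Definition hook_sum m i q := \sum_(l < i) hook m l.+1 q.

(* The hooks are non-empty and each of them is contained in the next one. *)
Definition hook_chain (m : nat -> nat) :=
  (forall i, m i.+1 <= i) /\ (forall i, m i <= m i.+1 <= (m i).+1).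

Lemma hook_nonincreasing m i : hook_chain m ->
  {homo hook m i.+1 : p q / p <= q >-> q <= p}.
Proof. by case=> /(_ i) + _ [|p] [|q] //= => ?; lia. Qed.

Lemma hook_le m i q : hook_chain m -> hook m i.+1 q <= hook m i.+2 q.
Proof.
by case=> _ /(_ i.+1); case: q => [|q] /=; lia.
Qed.

Lemma hook_sumS m i q : hook_sum m i.+1 q = hook_sum m i q + hook m i.+1 q.
Proof. exact: big_ord_recr. Qed.

Lemma hook_sum_nonincreasing m i : hook_chain m ->
  {homo hook_sum m i : p q / p <= q >-> q <= p}.
Proof.
by move=> Cm p q pq; apply: leq_sum => l _; apply: hook_nonincreasing.
Qed.

Lemma hook_chain_le m i j : hook_chain m -> i <= j -> m i <= m j.
Proof.
case=> _ Hm /subnKC <-; elim: (j - i) => [|d IH]; first by rewrite addn0.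
by rewrite addnS; have := Hm (i + d); lia.
Qed.

Lemma hook_sum_eq0 m i q : hook_chain m -> m i < q -> hook_sum m i q = 0.
Proof.
move=> Cm miq; apply: big1 => l _; case: q miq => [|q] //= miq.
by have := hook_chain_le Cm (ltn_ord l); lia.
Qed.

Lemma hook_sum_gt0 m i q : hook_chain m -> q <= m i.+1 -> 0 < hook_sum m i.+1 q.
Proof. by case=> /(_ i) ? _; rewrite hook_sumS; case: q => [|q] /=; lia. Qed.

Lemma sum_hook_prefix m i t :
  \sum_(q < t.+1) hook m i.+1 q = i.+1 - m i.+1 + minn t (m i.+1).
Proof.
rewrite big_ord_recl; congr (_ + _).
under eq_bigr do rewrite lift0 /=.
elim: t => [|t IH]; first by rewrite big_ord0; lia.
by rewrite big_ord_recr /= IH; lia.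
Qed.

Lemma sum_hook m i Q : hook_chain m -> m i.+1 < Q ->
  \sum_(q < Q) hook m i.+1 q = i.+1.
Proof. by case: Q => // Q Cm mQ; rewrite sum_hook_prefix; have := Cm.1 i; lia. Qed.

Lemma sum_hook_sumS m i t :
  \sum_(q < t) hook_sum m i.+1 q =
  \sum_(q < t) hook_sum m i q + \sum_(q < t) hook m i.+1 q.
Proof. by rewrite -big_split; apply: eq_bigr => q _; apply: hook_sumS. Qed.

Lemma sum_hook_sum m i Q : hook_chain m -> m i < Q ->
  \sum_(q < Q) hook_sum m i q = 'C(i.+1, 2).
Proof.
move=> Cm; elim: i => [|i IH] mQ.
  by rewrite big1 // => q _; rewrite /hook_sum big_ord0.
have mi : m i < Q by case: (Cm) => _ /(_ i); lia.
by rewrite sum_hook_sumS IH // sum_hook // [in RHS]binS bin1.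
Qed.

(* Column [l] contributes [h - 1] to the difference of the two sides of
   [hook_gap] if [s] is a leg of the hook, and [l] otherwise; the former
   decreases by at most one from one column to the previous one. *)
Lemma hook_gap_aux m s d H : hook_chain m -> H <= d ->
  H < s.+1 + d - m (s.+1 + d) ->
  2 * (s.+1 * hook_sum m (s.+1 + d) s.+1) + s.+1 * s.+2 + H * H.+1
    <= 2 * \sum_(q < s.+1) hook_sum m (s.+1 + d) q.
Proof.
move=> Cm; elim: d H => [|d IH] H Hd Hh.
  have -> : H = 0 by lia.
  rewrite addn0 hook_sum_eq0 //; last by case: (Cm) => /(_ s).
  have mss : m s.+1 < s.+1 by case: (Cm) => /(_ s).
  by rewrite sum_hook_sum //; have := mul_bin_diag s.+2 1; rewrite /= bin1; nia.
have {}IH : 2 * (s.+1 * hook_sum m (s.+1 + d) s.+1) + s.+1 * s.+2 + H.-1 * H.-1.+1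
    <= 2 * \sum_(q < s.+1) hook_sum m (s.+1 + d) q.
  apply: IH; first lia.
  rewrite addnS in Hh; case: (Cm) => /(_ (s + d)) + /(_ (s.+1 + d)).
  by rewrite -addSn; lia.
rewrite addnS in Hh *; rewrite sum_hook_sumS hook_sumS sum_hook_prefix /=.
have HH : H * H.+1 = H.-1 * H.-1.+1 + 2 * H by case: (H) => [|a]; nia.
have := Cm.1 (s.+1 + d); rewrite mulnDr HH.
move: IH; move: (hook_sum _ _ _) (\sum_(_ < _) _) (H.-1 * _) (s.+1 * s.+2) => a b u v.
by case: (leqP s.+1 (m (s.+1 + d).+1)) => sm; rewrite ?muln1 ?muln0 /=; lia.
Qed.

(** Take [hook_gap_aux] with [H] the arm minus one. This pays for the loss in [majorized_sub_hook]
    when the arm reaches below the threshold. *)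
Lemma hook_gap m s i : hook_chain m -> 0 < s <= m i ->
  s * hook_sum m i s + s.+1 * (i - m i).-1 <= \sum_(q < s) hook_sum m i q.
Proof.
move=> Cm; case: s => // s smi.
case: i smi => [|i] smi; first by case: Cm => /(_ 0) + /(_ 0); lia.
have mi : m i.+1 <= i by case: Cm.
have := @hook_gap_aux m s (i - s) (i.+1 - m i.+1).-1 Cm.
rewrite addSn.
have -> : s + (i - s) = i by lia.
move=> /(_ ltac:(lia) ltac:(lia)).
(* With [a = s.+1] and [h] the arm minus one, the difference of the two sides is
   [(a - h) * (a - h + 1)], a product of consecutive integers. *)
have : 2 * (s.+2 * (i.+1 - m i.+1).-1) <=
    s.+1 * s.+2 + (i.+1 - m i.+1).-1 * (i.+1 - m i.+1).-1.+1.
  by move: (i.+1 - _).-1 => h; case: (leqP h s.+1) => [/subnKC|/subnKC] <-; nia.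
lia.
Qed.

(** * Majorization and the removal of one sorted hook *)

Lemma sum_minus_const Q (g : nat -> nat) t w : t <= Q ->
  \sum_(q < t) g q <= \sum_(q < Q) (g q - w) + t * w.
Proof.
move=> tQ; apply: leq_trans (leq_add (leq_sum_ord (fun q => g q - w) tQ) (leqnn _)).
rewrite -[t in t * w]card_ord -sum_nat_const -big_split /=.
by apply: leq_sum => q _; lia.
Qed.

(* Majorization in threshold form, which needs no sorting; equality of the
   totals is assumed separately. *)
Definition majorized Q (y L : nat -> nat) :=
  forall w, \sum_(q < Q) (y q - w) <= \sum_(q < Q) (L q - w).

(** Use the threshold [L t]: beyond slot [t] the truncated entries of [L] vanish, and on the first
    [t.+1] slots truncation loses nothing of [L]. *)
Lemma majorized_prefix Q y L t : majorized Q y L -> t < Q ->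
  {homo L : p q / p <= q >-> q <= p} ->
  \sum_(q < t.+1) y q <= \sum_(q < t.+1) L q.
Proof.
move=> yL tQ L_dec; apply: leq_trans (sum_minus_const y (L t) tQ) _.
apply: leq_trans (leq_add (yL (L t)) (leqnn _)) _.
rewrite -(subnKC tQ) big_split_ord /= [X in _ + X + _]big1 ?addn0; last first.
  by move=> q _; have := L_dec t (t.+1 + q); lia.
have -> : t.+1 * L t = \sum_(q < t.+1) L t by rewrite sum_nat_const card_ord.
rewrite -big_split /=; apply: leq_sum => q _.
by have := L_dec q t; have := ltn_ord q; lia.
Qed.

(** At threshold 1 each side loses the number of its positive entries, and [hook_sum m i.+1] has
    exactly [(m i.+1).+1] of them. *)
Lemma majorized_gt0 Q m i y : hook_chain m -> m i.+1 < Q ->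
  {homo y : p q / p <= q >-> q <= p} ->
  \sum_(q < Q) y q = \sum_(q < Q) hook_sum m i.+1 q ->
  majorized Q y (hook_sum m i.+1) -> forall q, q <= m i.+1 -> 0 < y q.
Proof.
move=> Cm mQ y_dec y_sum /(_ 1) maj q qm.
have [n nQ n_y] := nonincreasing_threshold Q 0 y_dec.
suff mn : m i.+1 < n by rewrite n_y; lia.
have L_eq : \sum_(q < Q) (hook_sum m i.+1 q - 1) + (m i.+1).+1
          = \sum_(q < Q) hook_sum m i.+1 q.
  rewrite -{1}(sum_ltn_ord mQ) -big_split; apply: eq_bigr => p _ /=.
  case: (leqP p (m i.+1)) => pm; first by have := hook_sum_gt0 Cm pm; lia.
  by rewrite hook_sum_eq0 //; lia.
have y_eq : \sum_(q < Q) (y q - 1) + n = \sum_(q < Q) y q.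
  rewrite -{1}(sum_ltn_ord nQ) -big_split; apply: eq_bigr => p _ /=.
  by rewrite -n_y //; lia.
lia.
Qed.

(** For a threshold [w], let [n] count the rows above [w]. The cases are whether row 0 still reaches
    [w] after losing the arm, and whether the legs cover all other rows above [w]. *)
Lemma majorized_sub_hook Q m i y : hook_chain m -> m i.+1 < Q ->
  {homo y : p q / p <= q >-> q <= p} ->
  \sum_(q < Q) y q = \sum_(q < Q) hook_sum m i.+1 q ->
  majorized Q y (hook_sum m i.+1) -> i.+1 - m i.+1 <= y 0 ->
  (forall q, hook m i.+1 q <= y q) /\
  majorized Q (fun q => y q - hook m i.+1 q) (hook_sum m i).
Proof.
move=> Cm mQ y_dec y_sum maj h_y0.
have y_gt0 := majorized_gt0 Cm mQ y_dec y_sum maj.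
split=> [[|q] //=|w]; first by case: leqP => // /y_gt0.
have h_gt0 : 0 < i.+1 - m i.+1 by have := Cm.1 i; lia.
have L_dec := hook_sum_nonincreasing i.+1 Cm.
have hook_tot := sum_hook Cm mQ.
case: Q mQ y_sum maj hook_tot y_gt0 => // Q.
rewrite ltnS => mQ y_sum maj hook_tot y_gt0.
have [n nQ n_y] := nonincreasing_threshold Q.+1 w y_dec.
have n_y' (q : 'I_Q.+1) := n_y q (ltn_ord q).
have hS q := hook_sumS m i q.
case: (leqP (w + (i.+1 - m i.+1)) (y 0)) => h_w.
  have n_gt0 : 0 < n by rewrite -n_y; lia.
  case: (leqP n (m i.+1).+1) => n_m.
    (* Every other row above [w] carries a leg, so past row 0 losing the leg amounts to raising the
       threshold to [w.+1]. *)
    have := maj w.+1; rewrite !big_ord_recl.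
    have y0L0 : y 0 <= hook_sum m i.+1 0.
      have := majorized_prefix maj (ltn0Sn Q) L_dec.
      by rewrite !big_ord_recl !big_ord0 !addn0.
    have : \sum_(q < Q) (y (lift ord0 q) - hook m i.+1 (lift ord0 q) - w)
        <= \sum_(q < Q) (y (lift ord0 q) - w.+1).
      apply: leq_sum => q _; rewrite lift0 /=.
      by have := n_y q.+1 (ltn_ord q); case: leqP => /=; lia.
    have : \sum_(q < Q) (hook_sum m i.+1 (lift ord0 q) - w.+1)
        <= \sum_(q < Q) (hook_sum m i (lift ord0 q) - w).
      by apply: leq_sum => q _; rewrite lift0 hS /=; case: leqP => /=; lia.
    by have := hS 0; rewrite /=; lia.
  (* All cells of the hook are removed from above [w]: the left side falls by the full size of the
     hook, the right side by at most that. *)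
  have : \sum_(q < Q.+1) (y q - hook m i.+1 q - w)
      + \sum_(q < Q.+1) hook m i.+1 q <= \sum_(q < Q.+1) (y q - w).
    rewrite -big_split; apply: leq_sum => -[[|q] qQ] _ /=; first lia.
    by have := n_y q.+1 qQ; case: (leqP q.+1 (m i.+1)); lia.
  have : \sum_(q < Q.+1) (hook_sum m i.+1 q - w)
      <= \sum_(q < Q.+1) (hook_sum m i q - w) + \sum_(q < Q.+1) hook m i.+1 q.
    rewrite -big_split; apply: leq_sum => q _ /=.
    by rewrite hS; lia.
  by have := maj w; lia.
(* The largest row drops below [w].  If at most [m i.+1] other rows exceed [w],
   their sum is bounded by averaging over the top [s.+1] rows, and [hook_gap]
   absorbs the loss. *)
case: n nQ n_y n_y' => [|s] nQ n_y n_y'.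
  by rewrite big1 // => q _; have := n_y' q; lia.
case: (leqP s (m i.+1)) => s_m.
  have z_sum : \sum_(q < Q.+1) (y q - hook m i.+1 q - w) + s * w.+1 + y 0
      <= \sum_(q < s.+1) y q.
    rewrite !big_ord_recl /= (_ : y 0 - _ - w = 0); last lia.
    rewrite add0n addnC leq_add2l (big_ord_widen Q (fun q => y q.+1)) //.
    rewrite -[s in s * _](sum_ltn_ord (Q := Q)) // big_distrl /= -big_split.
    rewrite [X in _ <= X]big_mkcond; apply: leq_sum => q _ /=.
    have := n_y q.+1 (ltn_ord q); rewrite /bump add1n ltnS.
    by case: (leqP q.+1 s); case: (leqP q.+1 (m i.+1)); lia.
  have y_pre : \sum_(q < s.+1) y q <= s.+1 * y 0.
    rewrite -[s.+1 in X in _ <= X]card_ord -sum_nat_const.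
    by apply: leq_sum => q _; apply: y_dec.
  case: s nQ n_y n_y' s_m z_sum y_pre => [|s] nQ n_y n_y' s_m z_sum y_pre.
    by move: z_sum; rewrite big_ord1 => /= z_sum; lia.
  have L_pre := sum_hook_sumS m i s.+1.
  rewrite sum_hook_prefix (minn_idPl (ltnW s_m)) in L_pre.
  have yL := majorized_prefix maj nQ L_dec.
  rewrite [X in _ <= X]big_ord_recr /= in yL.
  have L'_pre := sum_minus_const (hook_sum m i) w (ltnW nQ).
  have gap := hook_gap Cm (s_m : 0 < s.+1 <= m i.+1).
  (* Add [s.+1] times [yL], the bound [y_pre] and [gap], then divide by [s.+2]. *)
  have : \sum_(q < s.+2) y q + (i.+1 - m i.+1).-1
      <= \sum_(q < s.+1) hook_sum m i.+1 q + y 0.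
    rewrite -(leq_pmul2l (ltn0Sn s.+1)).
    have := leq_mul (leqnn s.+1) yL.
    move: y_pre gap; move: (\sum_(q < s.+2) _) (\sum_(q < s.+1) _) => P F.
    by move: (hook_sum m i.+1 s.+1) (_.-1) (y 0) => a b c; rewrite !mulnDr; lia.
  by lia.
(* Now [s] exceeds [m i.+1], and all legs are removed from above [w]. Comparing totals suffices, as
   [h_y0] pays for the arm. *)
have : \sum_(q < Q.+1) (y q - hook m i.+1 q - w) + (m i.+1 + s * w + y 0)
    <= \sum_(q < Q.+1) y q.
  rewrite !big_ord_recl /= (_ : y 0 - _ - w = 0); last lia.
  rewrite add0n addnC [_ + y 0]addnC -addnA leq_add2l.
  rewrite -{1}(sum_ltn_ord mQ) -[s in s * _](sum_ltn_ord (Q := Q)) //.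
  rewrite big_distrl /= -!big_split; apply: leq_sum => q _ /=.
  have := n_y q.+1 (ltn_ord q); rewrite /bump add1n ltnS.
  by case: (leqP q.+1 s); case: (leqP q.+1 (m i.+1)); lia.
have : \sum_(q < Q.+1) hook_sum m i.+1 q <=
   \sum_(q < Q.+1) (hook_sum m i q - w) + (m i.+1).+1 * w
   + \sum_(q < Q.+1) hook m i.+1 q.
  rewrite -(sum_ltn_ord (mQ : (m i.+1).+1 <= Q.+1)) big_distrl -!big_split /=.
  apply: leq_sum => q _; rewrite hS /=.
  case: (leqP q (m i.+1)) => qm; first by rewrite ltnS qm; lia.
  by rewrite hook_sum_eq0 //; case: (Cm) => _ /(_ i); lia.
by rewrite -y_sum hook_tot; nia.
Qed.

(** * Removal of the hooks from unsorted rows *)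

Lemma sum_set_le k (g : nat -> nat) (S : {set 'I_k}) :
  {homo g : p q / p <= q >-> q <= p} ->
  \sum_(q in S) g q <= \sum_(q < #|S|) g q.
Proof.
move=> g_dec; set t := #|S|; set w := g t.
have tk : t <= k by rewrite -[k]card_ord max_card.
have le1 : \sum_(q in S) g q <= \sum_(q in S) (g q - w) + t * w.
  by rewrite -sum_nat_const -big_split; apply: leq_sum => q _ /=; lia.
have le2 : \sum_(q in S) (g q - w) <= \sum_(q < k) (g q - w).
  by rewrite big_mkcond; apply: leq_sum => q _; case: ifP.
have le3 : \sum_(q < k) (g q - w) = \sum_(q < t) (g q - w).
  rewrite -(subnKC tk) big_split_ord /= [X in _ + X]big1 ?addn0 // => q _.
  by have := g_dec t (t + q); rewrite /w; lia.
have le4 : \sum_(q < t) (g q - w) + t * w = \sum_(q < t) g q.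
  rewrite -[t in t * w]card_ord -sum_nat_const -big_split /=.
  by apply: eq_bigr => q _; have := g_dec q t (ltnW (ltn_ord q)); rewrite /w; lia.
lia.
Qed.

Lemma sorting_perm k (x : 'I_k -> nat) :
  exists s : {perm 'I_k}, forall p q : 'I_k, p <= q -> x (s q) <= x (s p).
Proof.
pose t := [tuple x j | j < k].
have /tuple_permP[s s_eq] : perm_eq (sort_tuple geq t) t by rewrite perm_sort.
have x_s (q : 'I_k) : x (s q) = nth 0 (sort geq t) q.
  rewrite -[sort geq t]/(tval (sort_tuple geq t)) s_eq /=.
  by rewrite -(tnth_nth _ [tuple tnth t (s j) | j < k]) !tnth_mktuple.
exists s => p q pq; rewrite !x_s.
have t_sorted : sorted geq (sort geq t).
  by apply: sort_sorted => a b; rewrite /= leq_total.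
apply: (sorted_leq_nth _ _ 0 t_sorted) => //.
- by move=> a b c /= ab bc; apply: leq_trans ab.
- exact: leqnn.
- by rewrite inE size_sort size_tuple.
- by rewrite inE size_sort size_tuple.
Qed.

(** Sort the rows and pad them with zeros up to [Q]; the inverse of the sorting permutation sends a
    row to its slot. No cell of the hook fits in a padded row, hence [m i.+1 < k]. *)
Lemma peel_hook k Q m i (x : 'I_k -> nat) : hook_chain m -> m i.+1 < Q ->
  k <= Q -> \sum_j x j = \sum_(q < Q) hook_sum m i.+1 q ->
  (forall w, \sum_j (x j - w) <= \sum_(q < Q) (hook_sum m i.+1 q - w)) ->
  (exists j, i.+1 - m i.+1 <= x j) ->
  exists s : {perm 'I_k}, [/\ m i.+1 < k, forall j, hook m i.+1 (s j) <= x j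
    & forall w, \sum_j (x j - hook m i.+1 (s j) - w)
                  <= \sum_(q < Q) (hook_sum m i q - w)].
Proof.
move=> Cm mQ kQ x_sum maj [j0 hj0].
have [s s_dec] := sorting_perm x.
pose y q := oapp (fun j => x (s j)) 0 (insub q : option 'I_k).
have yE (q : 'I_k) : y q = x (s q) by rewrite /y valK.
have y0 q : k <= q -> y q = 0 by move=> kq; rewrite /y insubF //; lia.
have y_dec : {homo y : p q / p <= q >-> q <= p}.
  move=> p q pq; case: (ltnP q k) => qk; last by rewrite y0.
  have pk := leq_ltn_trans pq qk.
  by rewrite (yE (Ordinal qk)) (yE (Ordinal pk)) s_dec.
have sum_y (F : nat -> nat -> nat) : (forall q, F 0 q = 0) ->
    \sum_(q < Q) F (y q) q = \sum_j F (x j) ((s^-1)%g j).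
  move=> F0; rewrite -(subnKC kQ) big_split_ord /= [X in _ + X]big1 ?addn0.
    rewrite [RHS](reindex_inj (@perm_inj _ s)).
    by apply: eq_bigr => q _; rewrite yE permK.
  by move=> q _; rewrite y0 ?leq_addr.
have y_maj : majorized Q y (hook_sum m i.+1).
  by move=> w; rewrite (sum_y (fun v _ => v - w)).
have y_sum : \sum_(q < Q) y q = \sum_(q < Q) hook_sum m i.+1 q.
  by rewrite (sum_y (fun v _ => v)).
have h_y0 : i.+1 - m i.+1 <= y 0.
  by apply: leq_trans hj0 _; rewrite -(permKV s j0) -yE y_dec.
have [hook_y maj'] := majorized_sub_hook Cm mQ y_dec y_sum y_maj h_y0.
exists (s^-1)%g; split.
- case: ltnP => // km; have := hook_y (m i.+1); rewrite y0 //.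
  by have := Cm.1 i; case mi: (m i.+1) => [|a] /=; rewrite mi; lia.
- by move=> j; apply: leq_trans (hook_y _) _; rewrite yE permKV.
- by move=> w; rewrite -(sum_y (fun v q => v - hook m i.+1 q - w)).
Qed.

(* The hypotheses on [S] keep the largest entry of [x] above the arm of the next
   hook. *)
Lemma hook_decomposition k Q m i (x : 'I_k -> nat) (S : {set 'I_k}) :
  hook_chain m -> m i < Q -> k <= Q ->
  \sum_j x j = \sum_(q < Q) hook_sum m i q ->
  (forall w, \sum_j (x j - w) <= \sum_(q < Q) (hook_sum m i q - w)) ->
  0 < #|S| -> \sum_(q < #|S|) hook_sum m i q <= \sum_(j in S) x j ->
  (forall l, l < i -> l.+1 - m l.+1 <= 1 \/
     forall q, q < #|S| -> l.+1 - m l.+1 <= hook_sum m l.+1 q) ->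
  exists s : nat -> {perm 'I_k}, (forall l, l < i -> m l.+1 < k) /\
    forall j, \sum_(l < i) hook m l.+1 (s l j) = x j.
Proof.
move=> Cm + kQ; elim: i x => [|i IH] x mQ x_sum maj S_gt0 S_x S_h.
  exists (fun=> 1%g); split=> // j; rewrite big_ord0.
  suff : x j <= 0 by lia.
  have <- : \sum_j x j = 0.
    by rewrite x_sum big1 // => q _; rewrite /hook_sum big_ord0.
  by rewrite (bigD1 j) //= leq_addr.
have h_x : exists j, i.+1 - m i.+1 <= x j.
  case: (S_h i) => // [h1|hL].
    have /eqP : \sum_j x j != 0.
      rewrite x_sum; case: (Q) mQ => // Q' _.
      rewrite big_ord_recl /=; have := @hook_sum_gt0 m i 0 Cm; lia.
    move=> x_neq0; apply/existsP; apply: contra_notT x_neq0 => /existsPn x_lt.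
    by apply: big1 => j _; have := x_lt j; lia.
  (* Each of the first [#|S|] entries of the sum is at least the arm, so the rows of [S] average at
     least the arm and one of them reaches it. *)
  have : #|S| * (i.+1 - m i.+1) <= \sum_(j in S) x j.
    apply: leq_trans S_x; rewrite -[#|S| in X in X <= _]card_ord -sum_nat_const.
    by apply: leq_sum => q _; apply: hL.
  move=> S_h'; apply/existsP; move: S_h'; apply: contraLR => /existsPn x_lt.
  have [j jS] : exists j, j \in S by apply/set0Pn; rewrite -card_gt0.
  rewrite -ltnNge -sum_nat_const (bigD1 j) //= [X in _ < X](bigD1 j) //=.
  rewrite -addSn; apply: leq_add; first by have := x_lt j; lia.
  by apply: leq_sum => l _; have := x_lt l; lia.
have [s0 [mk hook_x maj']] := peel_hook Cm mQ kQ x_sum maj h_x.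
have miQ : m i < Q by case: (Cm) => _ /(_ i); lia.
(* A permuted hook takes from a set of rows at most what its sorted form has in as many first slots,
   so the bound [S_x] survives. *)
have s_le (U : {set 'I_k}) :
    \sum_(j in U) hook m i.+1 (s0 j) <= \sum_(q < #|U|) hook m i.+1 q.
  rewrite -(card_imset U (@perm_inj _ s0)).
  apply: leq_trans (sum_set_le _ (hook_nonincreasing i Cm)).
  by rewrite big_imset //= => a b _ _; apply: perm_inj.
have [] := IH (fun j => x j - hook m i.+1 (s0 j)) => //.
- have : \sum_j (x j - hook m i.+1 (s0 j)) + \sum_j hook m i.+1 (s0 j) = \sum_j x j.
    by rewrite -big_split; apply: eq_bigr => j _ /=; have := hook_x j; lia.
  have -> : \sum_j hook m i.+1 (s0 j) = i.+1.
    by rewrite -[RHS](sum_hook Cm mk) [RHS](reindex_inj (@perm_inj _ s0)).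
  by rewrite x_sum sum_hook_sumS sum_hook //; lia.
- have : \sum_(j in S) (x j - hook m i.+1 (s0 j)) + \sum_(j in S) hook m i.+1 (s0 j)
      = \sum_(j in S) x j.
    by rewrite -big_split; apply: eq_bigr => j _ /=; have := hook_x j; lia.
  by have := s_le S; rewrite sum_hook_sumS in S_x; lia.
- by move=> l li; apply: S_h; lia.
move=> s [mk' s_sum]; exists (fun l => if l == i then s0 else s l); split.
  by move=> l; rewrite ltnS leq_eqVlt => /orP[/eqP ->|/mk'].
move=> j; rewrite big_ord_recr /= eqxx -(subnK (hook_x j)) -s_sum; congr (_ + _).
by apply: eq_bigr => l _; rewrite ltn_eqF.
Qed.

(** * Search for a tight chain of hooks and splitting of the excesses *)

(* The [q]-th leg is present from the hook of size [q.+1] on for [q <= c], and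
   leg [c.+1] from the hook of size [b] on. *)
Definition hook_legs c b i := minn i.-1 c + (b <= i).

Lemma hook_legs_chain c b : c.+2 <= b -> hook_chain (hook_legs c b).
Proof. by move=> cb; split=> i; rewrite /hook_legs; lia. Qed.

Lemma leq_hook_legs_sum c b l q : c.+2 <= b -> q <= c ->
  l - q <= hook_sum (hook_legs c b) l q.
Proof.
move=> cb qc; elim: l => [|l IH]; first by rewrite sub0n.
have mE : hook_legs c b l.+1 = minn l c + (b <= l.+1) by [].
by rewrite hook_sumS; case: q qc IH => [|q] qc IH; rewrite /= mE; lia.
Qed.

(** Up to size [c.+1] the arm is a single cell. Beyond, it has at most [l.+1 - c] cells, and slot
    [q] has collected as many. *)
Lemma hook_legs_height c b l q : c.+2 <= b -> q <= c ->
  l.+1 - hook_legs c b l.+1 <= 1 \/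
  l.+1 - hook_legs c b l.+1 <= hook_sum (hook_legs c b) l.+1 q.
Proof.
move=> cb qc; have := leq_hook_legs_sum l.+1 cb qc.
have mE : hook_legs c b l.+1 = minn l c + (b <= l.+1) by [].
by case: (leqP l c) => lc; [left|right]; rewrite mE; lia.
Qed.

(** The two chains differ only in the hook of size [b], where one cell moves from the arm to leg
    [c.+1]. *)
Lemma hook_legs_sum_shift c b l q : c.+2 <= b ->
  hook_sum (hook_legs c b) l q + ((q == 0) && (b <= l)) =
  hook_sum (hook_legs c b.+1) l q + ((q == c.+1) && (b <= l)).
Proof.
move=> cb; elim: l => [|l IH]; first by rewrite /hook_sum !big_ord0; lia.
have mE a : hook_legs c a l.+1 = minn l c + (a <= l.+1) by [].
by rewrite !hook_sumS; case: q IH => [|q] /= IH; rewrite !mE; lia.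
Qed.

(** Once leg [c.+1] is in every hook of size [c.+2] or more, the search passes to the next leg,
    still absent up to size [e]. *)
Lemma hook_legs_full c e q :
  hook_sum (hook_legs c c.+2) e q = hook_sum (hook_legs c.+1 e.+1) e q.
Proof.
apply: eq_bigr => l _; have := ltn_ord l.
by case: q => [|q] /= le; rewrite /hook_legs; lia.
Qed.

(* Moving one cell of the hooks from the arm to the shortest leg keeps [x]
   majorized as long as no set of at most [c.+1] rows is tight. *)
Lemma majorized_shift k e c b (x : 'I_k -> nat) : c.+2 <= b <= e ->
  \sum_j x j = 'C(e.+1, 2) ->
  (forall w, \sum_j (x j - w)
     <= \sum_(q < k + e.+1) (hook_sum (hook_legs c b.+1) e q - w)) ->
  (forall S : {set 'I_k}, 0 < #|S| <= c.+1 ->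
     \sum_(j in S) x j < \sum_(q < #|S|) hook_sum (hook_legs c b.+1) e q) ->
  forall w, \sum_j (x j - w)
     <= \sum_(q < k + e.+1) (hook_sum (hook_legs c b) e q - w).
Proof.
move=> /andP[cb be] x_sum maj slack w.
set L := hook_sum (hook_legs c b.+1) e in maj slack.
set L' := hook_sum (hook_legs c b) e.
have LL' q : L' q + (q == 0) = L q + (q == c.+1).
  by have := @hook_legs_sum_shift c b e q cb; rewrite be !andbT.
have Cm : hook_chain (hook_legs c b.+1) by apply: hook_legs_chain; lia.
have me : hook_legs c b.+1 e <= c.+1 by rewrite /hook_legs; lia.
have [r rE] : exists r, k + e.+1 = c.+2 + r by exists (k + e.+1 - c.+2); lia.
have sumE (F : nat -> nat) : \sum_(q < k + e.+1) F q =
    F 0 + \sum_(q < c) F q.+1 + F c.+1 + \sum_(q < r) F (c.+2 + q).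
  by rewrite rE big_split_ord /= big_ord_recr big_ord_recl.
have mid : \sum_(q < c) (L' q.+1 - w) = \sum_(q < c) (L q.+1 - w).
  by apply: eq_bigr => q _; have := LL' q.+1; have := ltn_ord q; lia.
have last_sum : \sum_(q < r) (L' (c.+2 + q) - w)
    = \sum_(q < r) (L (c.+2 + q) - w).
  by apply: eq_bigr => q _; have := LL' (c.+2 + q); lia.
have sumL := sumE (fun q => L q - w); have sumL' := sumE (fun q => L' q - w).
have L0 := LL' 0; have Lc := LL' c.+1.
(* Only slots 0 and [c.+1] change, by one each. The right side falls only if [L c.+1 < w < L 0],
   where a strict inequality makes up for it. *)
have := maj w; case: (leqP (L 0) w) => Lw0; first by rewrite /= in L0 Lc; lia.
case: (leqP w (L c.+1)) => Lwc; first by rewrite /= in L0 Lc; lia.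
suff : \sum_j (x j - w) < \sum_(q < k + e.+1) (L q - w) by rewrite /= in L0 Lc; lia.
pose S := [set j | w < x j].
have x_S : \sum_j (x j - w) + #|S| * w = \sum_(j in S) x j.
  rewrite -sum_nat_const [X in _ + X]big_mkcond [in RHS]big_mkcond /= -big_split.
  by apply: eq_bigr => j _; rewrite /= !inE; case: leqP; lia.
have [S0|S_gt0] := posnP #|S|.
  by move: x_S; rewrite (cards0_eq S0) big_set0; lia.
have S_k : #|S| <= k by have := max_card S; rewrite card_ord.
case: (leqP #|S| c.+1) => Sc.
  have := slack S; rewrite S_gt0 Sc => /(_ isT).
  have SQ : #|S| <= k + e.+1 by lia.
  rewrite -x_S => slackS; have := leq_trans slackS (sum_minus_const L w SQ).
  by rewrite ltn_add2r.
(* At least [c.+2] rows exceed [w], so truncation costs [x] at least [c.+2 * w]. It costs [L] at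
   most [c.+1 * w + L c.+1], which is less, and the totals agree. *)
have : \sum_(q < k + e.+1) L q = 'C(e.+1, 2).
  by rewrite sum_hook_sum //; lia.
have : \sum_(j in S) x j <= \sum_j x j.
  by rewrite big_mkcond; apply: leq_sum => j _; case: ifP.
have : \sum_(q < k + e.+1) L q
    <= \sum_(q < k + e.+1) (L q - w) + c.+1 * w + L c.+1.
  rewrite sumL sumE [X in _ + X <= _]big1; last first.
    by move=> q _; rewrite /L hook_sum_eq0 //; lia.
  have : \sum_(q < c) L q.+1 <= \sum_(q < c) (L q.+1 - w) + c * w.
    by apply: (sum_minus_const (fun q => L q.+1)).
  lia.
have : c.+2 * w <= #|S| * w by rewrite leq_mul2r Sc orbT.
lia.
Qed.

(** The arms are shortened cell by cell until some set of rows is tight or every arm is a single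
    cell. *)
Lemma tight_hook_chain k e (x : 'I_k -> nat) :
  \sum_j x j = 'C(e.+2, 2) ->
  exists m, exists S : {set 'I_k}, [/\ hook_chain m, 0 < #|S|,
    forall w, \sum_j (x j - w) <= \sum_(q < k + e.+2) (hook_sum m e.+1 q - w),
    \sum_(q < #|S|) hook_sum m e.+1 q <= \sum_(j in S) x j &
    forall l, l < e.+1 -> l.+1 - m l.+1 <= 1 \/
      forall q, q < #|S| -> l.+1 - m l.+1 <= hook_sum m l.+1 q].
Proof.
move=> x_sum.
(* [d] bounds the steps left: [b] goes down to [c.+2], then [c] grows by one and [b] restarts at
   [e.+2], less than the weight [e + 3]. *)
have search d c b : (e - c) * (e + 3) + b <= d -> c.+2 <= b <= e.+2 ->
    (forall w, \sum_j (x j - w)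
       <= \sum_(q < k + e.+2) (hook_sum (hook_legs c b) e.+1 q - w)) ->
    exists c', exists2 b', c'.+2 <= b' <= e.+2 & (forall w, \sum_j (x j - w)
       <= \sum_(q < k + e.+2) (hook_sum (hook_legs c' b') e.+1 q - w)) /\
    (c' = e \/ exists2 S : {set 'I_k}, 0 < #|S| <= c'.+1 &
       \sum_(q < #|S|) hook_sum (hook_legs c' b') e.+1 q <= \sum_(j in S) x j).
  elim: d c b => [|d IH] c b bd cbe maj; first lia.
  have [ce|ce] := eqVneq c e; first by exists c, b; auto.
  have [/existsP[S /andP[Sc S_x]]|/existsPn slack] := boolP [exists S : {set 'I_k},
    (0 < #|S| <= c.+1) &&
    (\sum_(q < #|S|) hook_sum (hook_legs c b) e.+1 q <= \sum_(j in S) x j)].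
    by exists c, b => //; split=> //; right; exists S.
  case: b => // b in bd cbe maj slack.
  have [cb|cb] := ltnP c.+1 b.
    apply: (IH c b); [lia|lia|].
    apply: majorized_shift => //; first lia.
    by move=> S Sc; have := slack S; rewrite Sc -ltnNge.
  have bE : b = c.+1 by lia.
  apply: (IH c.+1 e.+2); [by nia | lia |] => w.
  apply: leq_trans (maj w) _; rewrite bE.
  by apply: leq_sum => q _; rewrite hook_legs_full.
(* At the start there are no legs up to size [e.+1]: all cells lie in slot 0, which majorizes every
   [x] of the same total. *)
have [||c [b cb [maj tight]]] := search _ 0 e.+2 (leqnn _); first lia.
  move=> w; have L0 : hook_sum (hook_legs 0 e.+2) e.+1 0 = 'C(e.+2, 2).
    rewrite -(@sum_hook_sum (hook_legs 0 e.+2) e.+1 1) ?big_ord1 //.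
      by apply: hook_legs_chain.
    by rewrite /hook_legs; lia.
  rewrite addnC big_ord_recl L0 -x_sum; apply: leq_trans (leq_addr _ _).
  by elim/big_rec2: _ => // j u v _; lia.
have Cm : hook_chain (hook_legs c b) by apply: hook_legs_chain; lia.
exists (hook_legs c b); case: tight => [ce|[S /andP[S_gt0 Sc] S_x]]; last first.
  exists S; split=> // l le.
  case: (leqP (l.+1 - hook_legs c b l.+1) 1) => h1; [by left | right=> q qS].
  by case: (@hook_legs_height c b l q); lia.
have k_gt0 : 0 < k.
  case: (posnP k) => // k0; have : 'C(e.+2, 2) = 0.
    by rewrite -x_sum big1 // => j; have := ltn_ord j; rewrite {2}k0.
  by rewrite binS bin1; lia.
(* All arms are single cells; the set of all rows qualifies because the totals agree. *)
exists [set: 'I_k]; rewrite cardsT card_ord; split=> //.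
  rewrite (eq_bigl xpredT) => [|j]; last by rewrite inE.
  rewrite x_sum -(@sum_hook_sum (hook_legs c b) e.+1 (k + e.+2)) //.
    by apply: leq_sum_ord; lia.
  by have := Cm.1 e; lia.
by move=> l le; left; rewrite /hook_legs; lia.
Qed.

Lemma star_forest_decomposition k e (x : 'I_k -> nat) :
  \sum_j x j = 'C(e.+1, 2) ->
  exists f : nat -> 'I_k -> nat, [/\ forall l, l < e -> \sum_j f l j = l.+1,
    forall j, \sum_(l < e) f l j = x j
  & forall l, l.+1 < e ->
      exists s : {perm 'I_k}, forall j, f l j <= f l.+1 (s j)].
Proof.
move=> x_sum.
case: e x_sum => [|e] x_sum.
  exists (fun _ _ => 0); split=> // j; rewrite big_ord0.
  suff : x j <= 0 by lia.
  by rewrite -[0]x_sum (bigD1 j) //= leq_addr.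
have [m [S [Cm S_gt0 maj S_x S_h]]] := tight_hook_chain x_sum.
have mQ : m e.+1 < k + e.+2.
  by have := Cm.1 e; lia.
have [|s [mk s_sum]] := hook_decomposition Cm mQ (leq_addr _ _) _ maj S_gt0 S_x S_h.
  by rewrite sum_hook_sum.
exists (fun l j => hook m l.+1 (s l j)); split=> [l le|j|l le].
- rewrite -[RHS](sum_hook Cm (mk l le)) [RHS](reindex_inj (@perm_inj _ (s l))).
  by apply: eq_bigr.
- exact: s_sum.
(* Row [j] goes to the row holding the same slot of the next hook. *)
- exists (s l * (s l.+1)^-1)%g => j; rewrite permM permKV; exact: hook_le.
Qed.

(** * Injections and disjoint choices of leaves *)

Lemma leq_card_inj (T : finType) (A B : {set T}) : #|A| <= #|B| ->
  exists h : T -> T, {in A &, injective h} /\ {in A, forall x, h x \in B}.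
Proof.
move=> AB; pose h x := nth x (enum B) (index x (enum A)).
have ltB x : x \in A -> index x (enum A) < size (enum B).
  by move=> xA; rewrite -cardE; apply: leq_trans AB; rewrite cardE index_mem mem_enum.
exists h; split=> [x y xA yA|x xA]; last by rewrite -mem_enum mem_nth ?ltB.
rewrite /h (set_nth_default x y) ?ltB // => /eqP.
rewrite nth_uniq ?ltB ?enum_uniq // => /eqP xy.
by rewrite -(nth_index x (_ : x \in enum A)) ?mem_enum // xy nth_index ?mem_enum.
Qed.

Lemma exists_subset_card (T : finType) (A : {set T}) n : n <= #|A| ->
  exists2 B : {set T}, B \subset A & #|B| = n.
Proof.
move=> nA; exists [set x in take n (enum A)].
  by apply/subsetP => x; rewrite inE => /mem_take; rewrite mem_enum.
rewrite cardsE (card_uniqP _) ?take_uniq ?enum_uniq // size_take_min -cardE.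
exact/minn_idPl.
Qed.

Lemma extend_injection (T : finType) (D : {set T}) (g : T -> T) :
  {in D &, injective g} -> exists f : {perm T}, {in D, f =1 g}.
Proof.
move=> g_inj; have : #|~: D| <= #|~: (g @: D)|.
  by rewrite [X in X <= _]cardsCs [X in _ <= X]cardsCs !setCK card_in_imset.
case/leq_card_inj=> h [h_inj hC].
pose f x := if x \in D then g x else h x.
have f_inj : injective f.
  move=> x y; rewrite /f; case: ifPn => xD; case: ifPn => yD; try exact: g_inj.
  - move=> gh; have := hC y; rewrite !inE -gh => /(_ yD)/negP[].
    exact: imset_f.
  - move=> gh; have := hC x; rewrite !inE gh => /(_ xD)/negP[].
    exact: imset_f.
  - by apply: h_inj; rewrite inE.
by exists (perm f_inj) => x xD; rewrite permE /f xD.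
Qed.

(** Serve the indices from the last one down: the sets already chosen use up at most the later
    demands, so [N j] keeps enough elements. *)
Lemma greedy_disjoint_subsets k (T : finType) (N : 'I_k -> {set T})
    (dem : 'I_k -> nat) :
  (forall j, 0 < dem j -> \sum_(q : 'I_k | j <= q) dem q <= #|N j|) ->
  exists M : 'I_k -> {set T}, [/\ forall j, M j \subset N j,
    forall j, #|M j| = dem j
  & forall j q, j != q -> [disjoint M j & M q]].
Proof.
move=> Hall.
have step d : exists M : 'I_k -> {set T}, [/\ forall j, M j \subset N j,
    forall j : 'I_k, k <= j + d -> #|M j| = dem j
  & forall j q, j != q -> [disjoint M j & M q]].
  elim: d => [|d [M [MN Mdem Mdis]]].
    exists (fun=> set0); split=> [j|j|j q _]; first exact: sub0set.
      by have := ltn_ord j; lia.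
    by rewrite disjoints_subset sub0set.
  have [dk|dk] := leqP k d.
    by exists M; split=> // j _; apply: Mdem; lia.
  have tk : k - d.+1 < k by lia.
  pose t := Ordinal tk; have tE : t = k - d.+1 :> nat by [].
  pose U := \bigcup_(q : 'I_k | t < q) M q.
  have card_U : #|U| <= \sum_(q : 'I_k | t < q) dem q.
    have -> : \sum_(q : 'I_k | t < q) dem q = \sum_(q : 'I_k | t < q) #|M q|.
      by apply: eq_bigr => q tq; rewrite Mdem //; move: tq; rewrite /=; lia.
    rewrite /U; elim/big_rec2: _ => [|q a V _ IH]; first by rewrite cards0.
    by apply: leq_trans (leq_card_setU _ _).1 _; rewrite leq_add2l.
  have [|B BN Bdem] := @exists_subset_card T (N t :\: U) (dem t).
    have [->//|dem_gt0] := posnP (dem t).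
    have := Hall t dem_gt0; rewrite (bigD1 t) //=.
    rewrite (eq_bigl (fun q : 'I_k => t < q)) => [|q]; last first.
      by rewrite -(inj_eq val_inj) /=; lia.
    move/(leq_trans (leq_add (leqnn (dem t)) card_U)).
    by have := subset_leq_card (subsetIr (N t) U); rewrite cardsD; lia.
  exists (fun j => if j == t then B else if t < j then M j else set0).
  have BM (q : 'I_k) : t < q -> [disjoint B & M q].
    move=> tq; apply: (disjointWr (_ : M q \subset U)); first exact: bigcup_sup.
    by rewrite disjoints_subset; apply: subset_trans BN _; rewrite setDE subsetIr.
  have BNt : B \subset N t by apply: subset_trans BN (subsetDl _ _).
  split=> [j|j|j q].
  - by case: eqP => [->//|_]; case: ifP => // _; apply: sub0set.
  - case: eqVneq => [->//|]; rewrite -(inj_eq val_inj) /= => jt kj.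
    by rewrite ifT; [apply: Mdem|]; lia.
  - move=> jq /=; case: (eqVneq j t) => jt; case: (eqVneq q t) => qt.
    + by rewrite jt qt eqxx in jq.
    + case: ifP => [tq|_]; first exact: BM.
      by rewrite disjoint_sym disjoints_subset sub0set.
    + case: ifP => [tj|_]; first by rewrite disjoint_sym; apply: BM.
      by rewrite disjoints_subset sub0set.
    + case: ifP => _; last by rewrite disjoints_subset sub0set.
      case: ifP => _; first exact: Mdis.
      by rewrite disjoint_sym disjoints_subset sub0set.
have [M [MN Mdem Mdis]] := step k; exists M; split=> // j.
by apply: Mdem; rewrite leq_addl.
Qed.

(** The levels are served from the top. What is left of [N j] matches the demands of the lower
    levels at [j], so induction applies. *)
Lemma peel_levels k (T : finType) n (N : 'I_k -> {set T})
    (dem : nat -> 'I_k -> nat) :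
  (forall j, #|N j| = \sum_(i < n) dem i j) ->
  (forall i, i < n -> forall j, 0 < dem i j ->
     \sum_(q : 'I_k | j <= q) dem i q <= \sum_(l < i.+1) dem l j) ->
  exists M : nat -> 'I_k -> {set T},
  [/\ forall i, i < n -> forall j, #|M i j| = dem i j,
      forall i, i < n -> forall j q, j != q -> [disjoint M i j & M i q],
      forall j x, (x \in N j) = [exists i : 'I_n, x \in M i j]
    & forall i l, i < n -> l < n -> i != l -> forall j, [disjoint M i j & M l j]].
Proof.
elim: n N => [|n IH] N N_card Hall.
  exists (fun _ _ => set0); split=> // j x.
  have /eqP : #|N j| = 0 by rewrite N_card big_ord0.
  rewrite cards_eq0 => /eqP ->; rewrite inE; apply/esym/existsP => -[[]] //.
have [|M [MN Mdem Mdis]] := @greedy_disjoint_subsets k T N (dem n).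
  by move=> j /Hall; rewrite N_card; apply.
have [||M' [Mdem' Mdis' MN' Mlev]] := IH (fun j => N j :\: M j).
- by move=> j; rewrite cardsDS // N_card Mdem big_ord_recr /= addnK.
- by move=> i ni; apply: Hall; lia.
have M'M i j : i < n -> [disjoint M' i j & M j].
  move=> ni; rewrite disjoints_subset; apply/subsetP => x xM'.
  have : x \in N j :\: M j by rewrite MN'; apply/existsP; exists (Ordinal ni).
  by rewrite !inE => /andP[].
exists (fun i => if i == n then M else M' i); split=> [i|i|j x|i l].
- by rewrite ltnS leq_eqVlt; case: eqP => [->//|_ /=]; apply: Mdem'.
- by rewrite ltnS leq_eqVlt; case: eqP => [//|_ /=]; apply: Mdis'.
- apply/idP/existsP=> [xN|[i]].
    have [xM|xM] := boolP (x \in M j).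
      by exists ord_max; rewrite /= eqxx.
    have : x \in N j :\: M j by rewrite inE xM.
    rewrite MN' => /existsP[i xi]; exists (widen_ord (leqnSn n) i).
    by rewrite /= ltn_eqF.
  case: eqVneq => [_|ni xM']; first exact: (subsetP (MN j)).
  have ltin : i < n by have := ltn_ord i; lia.
  suff : x \in N j :\: M j by rewrite inE => /andP[].
  by rewrite MN'; apply/existsP; exists (Ordinal ltin).
- move=> li ln il j.
  have [ni|ni] := eqVneq i n; have [nl|nl] := eqVneq l n.
  + by rewrite ni nl eqxx in il.
  + by rewrite disjoint_sym M'M //; lia.
  + by rewrite M'M //; lia.
  + by apply: Mlev => //; lia.
Qed.

(** * Demands of the parts at the centres *)

Lemma sum_staircase k n : k <= n ->
  \sum_(j < k) (n - j) + 'C((n - k).+1, 2) = 'C(n.+1, 2).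
Proof.
elim: k => [|k IH] kn; first by rewrite big_ord0 subn0.
rewrite big_ord_recr /= -IH; last lia.
have -> : n - k = (n - k.+1).+1 by lia.
by rewrite [in RHS]binS bin1 -addnA [X in _ + X]addnC.
Qed.

(** Level [i] is the part with [i.+1] edges; the third conclusion is what the greedy choice of
    leaves asks for. *)
Lemma star_levels n k (d : 'I_k -> nat) : k <= n ->
  (forall j : 'I_k, n - j <= d j) -> \sum_j d j = 'C(n.+1, 2) ->
  exists dem : nat -> 'I_k -> nat,
  [/\ forall j, d j = \sum_(i < n) dem i j,
      forall i, i < n -> \sum_j dem i j = i.+1,
      forall i, i < n -> forall j, 0 < dem i j ->
        \sum_(q : 'I_k | j <= q) dem i q <= \sum_(l < i.+1) dem l j
    & forall i, i.+1 < n ->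
        exists s : {perm 'I_k}, forall j, dem i j <= dem i.+1 (s j)].
Proof.
move=> kn d_ge d_sum; set e := n - k.
have excess : \sum_j (d j - (n - j)) = 'C(e.+1, 2).
  have : \sum_(j < k) (d j - (n - j)) + \sum_(j < k) (n - j) = 'C(n.+1, 2).
    by rewrite -d_sum -big_split; apply: eq_bigr => j _ /=; have := d_ge j; lia.
  suff <- : \sum_(j < k) (n - j) + 'C(e.+1, 2) = 'C(n.+1, 2).
    by rewrite addnC => /addnI.
  exact: sum_staircase.
have [f [f_col f_row f_mono]] := star_forest_decomposition excess.
(* From level [k] on, all [k] rows have their single edge, and [f (i - k)] of sum [i - k + 1]
   completes the [i.+1] edges. *)
pose dem i (j : 'I_k) := (j <= i) + (if k <= i then f (i - k) j else 0).
have dem_col i : i < n -> \sum_j dem i j = i.+1.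
  move=> ni; rewrite big_split /=; case: (leqP k i) => ki.
    rewrite f_col; last by rewrite /e; lia.
    rewrite (eq_bigr (fun=> 1)) => [|j _]; last by have := ltn_ord j; lia.
    by rewrite sum_nat_const card_ord; lia.
  by rewrite [X in _ + X]big1 // addn0; apply: (sum_ltn_ord (n := i.+1)).
have base_row j i : \sum_(l < i) (j <= l) = i - j.
  elim: i => [|i IH]; first by rewrite big_ord0.
  by rewrite big_ord_recr /= IH; lia.
exists dem; split=> // [j|i ni j dem_gt0|i ni].
- rewrite big_split /= base_row -{1}(subnKC (d_ge j)) -f_row; congr (_ + _).
  rewrite -[in RHS](subnKC kn) big_split_ord /= [X in _ = X + _]big1 ?add0n.
    by apply: eq_bigr => l _; rewrite leq_addr addKn.
  by move=> l _; rewrite leqNgt ltn_ord.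
- have ji : j <= i by move: dem_gt0 (ltn_ord j); rewrite /dem; case: (leqP k i); lia.
  have row : i.+1 - j <= \sum_(l < i.+1) dem l j.
    by rewrite -base_row; apply: leq_sum => l _; rewrite leq_addr.
  have : \sum_(q : 'I_k | j <= q) dem i q + \sum_(q : 'I_k | ~~ (j <= q)) dem i q = i.+1.
    by rewrite -dem_col // [RHS](bigID (fun q : 'I_k => j <= q)).
  (* The earlier rows demand at least one edge each, which leaves at most [i.+1 - j]; row [j] has
     that many. *)
  suff : j <= \sum_(q : 'I_k | ~~ (j <= q)) dem i q by lia.
  rewrite -{1}(sum_ltn_ord (ltnW (ltn_ord j))) [X in _ <= X]big_mkcond.
  by apply: leq_sum => q _; rewrite /dem -ltnNge; case: ltnP => /=; lia.
- have [ki|ki] := leqP k i; last first.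
    by exists 1%g => j; rewrite perm1 /dem [k <= i]leqNgt ki /=; lia.
  have [|s f_s] := f_mono (i - k); first by rewrite /e; lia.
  exists s => j; rewrite /dem ki (leqW ki) subSn //.
  by have := ltn_ord (s j); have := f_s j; lia.
Qed.

(** * Edges, components and star forests *)

Lemma mem_edges (T : finType) (G : sgraph T) x y :
  ([set x; y] \in edges G) = adj G x y.
Proof.
apply/imsetP/idP=> [[[a b]]|xy]; last by exists (x, y); rewrite ?inE.
rewrite inE /= => ab /setP xy_ab.
have := xy_ab x; have := xy_ab y; have := xy_ab a; have := xy_ab b.
rewrite !inE !eqxx /= !orbT.
have ba : adj G b a by rewrite adj_sym.
have := adj_irrefl G a.
case: (eqVneq x a) ab ba => [->|xa] ab ba aa.
  case: (eqVneq y b) => [->//|yb]; case: (eqVneq b a) => [ba'|//].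
  by rewrite ba' aa in ab.
case: (eqVneq x b) => [->|//]; case: (eqVneq y a) => [->//|//].
Qed.

Lemma edgesP (T : finType) (G : sgraph T) e :
  reflect (exists x y, adj G x y /\ e = [set x; y]) (e \in edges G).
Proof.
apply: (iffP imsetP) => [[[x y]]|[x [y [xy ->]]]].
  by rewrite inE => xy ->; exists x, y.
by exists (x, y); rewrite ?inE.
Qed.

(** Each edge is counted once, at its end in [A]. *)
Lemma card_edges_bipartite (T : finType) (G : sgraph T) (A : {set T}) :
  (forall x y, adj G x y -> (x \in A) = (y \notin A)) ->
  #|edges G| = \sum_(a in A) degree G a.
Proof.
move=> bip; pose E := [set p : T * T | (p.1 \in A) && adj G p.1 p.2].
have -> : edges G = [set [set p.1; p.2] | p in E].
  apply/setP => e; apply/edgesP/imsetP => [[x [y [xy ->]]]|[[x y]]].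
    have [xA|xA] := boolP (x \in A); first by exists (x, y); rewrite // inE xA.
    exists (y, x); rewrite /= 1?setUC // inE /= adj_sym xy andbT.
    by move: xA; rewrite (bip _ _ xy) negbK.
  by rewrite inE => /andP[_ xy] ->; exists x, y.
rewrite card_in_imset => [|[x y] [x' y']].
  rewrite -sum1_card /degree.
  under [RHS]eq_bigr do rewrite -sum1_card.
  rewrite pair_big_dep /=; apply: eq_bigl => -[x y].
  by rewrite !inE.
rewrite !inE /= => /andP[xA xy] /andP[x'A xy'] e_eq.
have yA : y \notin A by rewrite -(bip _ _ xy).
have yA' : y' \notin A by rewrite -(bip _ _ xy').
move/setP: e_eq => e_eq; have := e_eq x; have := e_eq y; rewrite !inE !eqxx orbT /=.
case: (eqVneq y x') => [yx'|_ /= /esym/eqP ->]; first by rewrite yx' x'A in yA.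
case: (eqVneq x x') => [->//|_ /= /esym/eqP xy'']; first by rewrite -xy'' xA in yA'.
Qed.

(** A walk from [c] can only go to a neighbour and back, so the component is [c] with its
    neighbours. *)
Lemma star_on_component (T : finType) (G : sgraph T) c :
  (forall y z, adj G c y -> adj G y z -> z = c) -> star_on G (component G c).
Proof.
move=> hub; have comp x : x \in component G c -> x = c \/ adj G c x.
  rewrite inE => /connectP[p]; elim/last_ind: p x => [|p z IH] x /=; first by left.
  rewrite rcons_path last_rcons => /andP[cp pz] ->.
  case: (IH _ cp erefl) => [pc|cpz]; first by right; rewrite -pc.
  by left; apply: hub pz.
exists c => [|x y /comp[->|cx] /comp[->|cy]]; first by rewrite inE connect0.
- by rewrite adj_irrefl eqxx.
- by rewrite cy eqxx andbT; apply/esym; apply: contraTneq cy => ->; rewrite adj_irrefl.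
- rewrite adj_sym cx eqxx orbT andbT; apply/esym.
  by apply: contraTneq cx => ->; rewrite adj_irrefl.
- have neq z : adj G c z -> (z == c) = false.
    by move=> cz; apply: contraTF cz => /eqP ->; rewrite adj_irrefl.
  rewrite !neq // andbF; apply: contraTF cy => xy.
  by rewrite (hub _ _ cx xy) adj_irrefl.
Qed.

(** One of the first two vertices of a cycle is off [A], and its two neighbours on the cycle would
    coincide. *)
Lemma leaves_star_forest (T : finType) (G : sgraph T) (A : {set T}) :
  (forall x y, adj G x y -> (x \in A) = (y \notin A)) ->
  (forall x a b, x \notin A -> adj G x a -> adj G x b -> a = b) ->
  star_forest G.
Proof.
move=> bip leaf; split=> [[|x [|y [|z c]]] //= _|x].
  rewrite /ucycle /= rcons_path => /andP[/and4P[xy yz _ lx]].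
  have [yA|yA] := boolP (y \in A); last first.
    move: xy; rewrite adj_sym => yx.
    by rewrite (leaf _ _ _ yA yx yz) !inE eqxx orbT.
  have xA : x \notin A by rewrite (bip _ _ xy) yA.
  move: lx; rewrite adj_sym => xl.
  rewrite (leaf _ _ _ xA xy xl) => /and3P[_].
  by rewrite mem_last.
have hubA a : a \in A -> star_on G (component G a).
  move=> aA; apply: star_on_component => y z ay yz.
  have yA : y \notin A by rewrite -(bip _ _ ay).
  by apply: leaf yA yz _; rewrite adj_sym.
have [xA|xA] := boolP (x \in A); first exact: hubA.
have [/existsP[a xa]|/existsPn iso] := boolP [exists a, adj G x a]; last first.
  by apply: star_on_component => y z xy; have := iso y; rewrite xy.
have aA : a \in A by apply: contraNT xA => aA; rewrite (bip _ _ xa).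
suff -> : component G x = component G a by apply: hubA.
apply/setP => y; rewrite !inE.
have symG : connect_sym (adj G) by apply: sym_connect_sym; apply: adj_sym.
exact: same_connect (connect1 xa) y.
Qed.

Lemma isomorphic_to_subgraph (T : finType) (G H : sgraph T) (f : {perm T}) :
  (forall x y, adj G x y -> adj H (f x) (f y)) ->
  exists2 K, subgraph K H & isomorphic G K.
Proof.
move=> fGH; pose e x y := adj G ((f^-1)%g x) ((f^-1)%g y).
have e_sym : symmetric e by move=> x y; apply: adj_sym.
have e_irr : irreflexive e by move=> x; apply: adj_irrefl.
exists (SGraph e_sym e_irr) => [x y /fGH|]; first by rewrite !permKV.
exists f; first by exists (f^-1)%g => x; rewrite ?permK ?permKV.
by move=> x y; rewrite /= /e !permK.
Qed.

(** * Graphs given by centres and sets of leaves *)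

Definition hub_rel (T : finType) k (r : 'I_k -> T) (M : 'I_k -> {set T}) x y :=
  [exists j, (x == r j) && (y \in M j)].

(** The conjunct [x != y] gives irreflexivity for all [r] and [M], so the graph exists before
    [hub_family] is known. *)
Definition hub_adj (T : finType) k (r : 'I_k -> T) (M : 'I_k -> {set T}) x y :=
  (x != y) && (hub_rel r M x y || hub_rel r M y x).

Lemma hub_adj_sym (T : finType) k (r : 'I_k -> T) (M : 'I_k -> {set T}) :
  symmetric (hub_adj r M).
Proof. by move=> x y; rewrite /hub_adj eq_sym orbC. Qed.

Lemma hub_adj_irrefl (T : finType) k (r : 'I_k -> T) (M : 'I_k -> {set T}) :
  irreflexive (hub_adj r M).
Proof. by move=> x; rewrite /hub_adj eqxx. Qed.

Definition hub_graph (T : finType) k (r : 'I_k -> T) (M : 'I_k -> {set T}) :=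
  SGraph (@hub_adj_sym T k r M) (@hub_adj_irrefl T k r M).

(* [r] lists the centres and [M] their sets of leaves. *)
Definition hub_family (T : finType) (A : {set T}) k (r : 'I_k -> T)
    (M : 'I_k -> {set T}) :=
  [/\ injective r, forall j, r j \in A, forall j, [disjoint M j & A]
    & forall j q, j != q -> [disjoint M j & M q]].

Lemma disjoint_notin (T : finType) (A B : {set T}) x :
  [disjoint A & B] -> x \in A -> x \notin B.
Proof. by rewrite disjoints_subset => /subsetP AB /AB; rewrite inE. Qed.

Lemma hub_graph_adjl (T : finType) A k (r : 'I_k -> T) M j y :
  hub_family A r M -> adj (hub_graph r M) (r j) y = (y \in M j).
Proof.
case=> r_inj rA MA _; apply/idP/idP=> [|yM]; rewrite /= /hub_adj.
  case/andP=> _ /orP[/existsP[q /andP[/eqP/r_inj -> //]]|/existsP[q /andP[_]]].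
  by move/(disjoint_notin (MA q)); rewrite rA.
have ryj : r j != y.
  by apply: contraTneq (rA j) => ->; apply: disjoint_notin (MA j) yM.
by rewrite ryj; apply/orP; left; apply/existsP; exists j; rewrite eqxx.
Qed.

Lemma hub_graph_adjP (T : finType) A k (r : 'I_k -> T) M x y :
  hub_family A r M -> x \in A ->
  reflect (exists2 j, x = r j & y \in M j) (adj (hub_graph r M) x y).
Proof.
move=> hM xA; apply: (iffP idP) => [|[j -> yM]]; last first.
  by rewrite (hub_graph_adjl _ _ hM).
case: hM => _ _ MA _; rewrite /= /hub_adj.
case/andP=> _ /orP[] /existsP[j /andP[/eqP xr yM]].
  by exists j.
by have := disjoint_notin (MA j) yM; rewrite xA.
Qed.

Lemma hub_graph_bipartite (T : finType) A k (r : 'I_k -> T) M :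
  hub_family A r M ->
  forall x y, adj (hub_graph r M) x y -> (x \in A) = (y \notin A).
Proof.
case=> _ rA MA _ x y /andP[_ /orP[]] /existsP[j /andP[/eqP ->]];
  move=> /(disjoint_notin (MA j)) zA.
  by rewrite rA zA.
by rewrite rA (negbTE zA).
Qed.

Lemma hub_graph_star_forest (T : finType) A k (r : 'I_k -> T) M :
  hub_family A r M -> star_forest (hub_graph r M).
Proof.
move=> hM; apply: (@leaves_star_forest _ _ A); first exact: hub_graph_bipartite hM.
move=> x a b xA xa xb; have bip := hub_graph_bipartite hM.
have aA : a \in A by have := bip _ _ xa; rewrite (negbTE xA) => /esym/negbFE.
have bA : b \in A by have := bip _ _ xb; rewrite (negbTE xA) => /esym/negbFE.
move: xa xb; rewrite ![adj _ x _]adj_sym => /(hub_graph_adjP x hM aA)[j -> xj].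
move=> /(hub_graph_adjP x hM bA)[q -> xq].
case: hM => _ _ _ Mdis; have [->//|jq] := eqVneq j q.
by have := disjoint_notin (Mdis _ _ jq) xj; rewrite xq.
Qed.

Lemma card_edges_hub_graph (T : finType) A k (r : 'I_k -> T) M :
  hub_family A r M -> #|edges (hub_graph r M)| = \sum_j #|M j|.
Proof.
move=> hM; rewrite (card_edges_bipartite (hub_graph_bipartite hM)).
have [r_inj rA _ _] := hM.
rewrite (bigID (fun a => a \in [set r j | j : 'I_k])) /= [X in _ + X]big1 ?addn0.
  rewrite (eq_bigl (fun a => a \in [set r j | j : 'I_k])) => [|a]; last first.
    by case: imsetP => [[j _ ->]|]; rewrite ?rA ?andbF.
  rewrite big_imset /= => [|j q _ _ /r_inj //]; apply: eq_bigr => j _.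
  by apply: eq_card => y; rewrite inE (hub_graph_adjl _ _ hM).
move=> a /andP[aA ar]; apply: eq_card0 => y; rewrite inE.
apply: contraNF ar => /(hub_graph_adjP y hM aA)[j -> _]; exact: imset_f.
Qed.

(** Centre [r j] goes to [r (s j)], and its leaves inject into those of [s j]. This map is injective
    on the covered vertices [D] and extends to a permutation of [T]. *)
Lemma hub_graph_embedding (T : finType) A k (r : 'I_k -> T) M M'
    (s : {perm 'I_k}) :
  hub_family A r M -> hub_family A r M' -> (forall j, #|M j| <= #|M' (s j)|) ->
  exists2 K, subgraph K (hub_graph r M') & isomorphic (hub_graph r M) K.
Proof.
move=> hM hM' le_s; have [r_inj rA MA Mdis] := hM; have [_ _ MA' Mdis'] := hM'.
have /fin_all_exists[h h_P] j := leq_card_inj (le_s j).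
pose g x := if [pick j | x == r j] is Some j then r (s j)
            else if [pick j | x \in M j] is Some j then h j x else x.
pose D := [set x | [exists j, (x == r j) || (x \in M j)]].
have gr j : g (r j) = r (s j).
  by rewrite /g; case: pickP => [q /eqP/r_inj -> //|/(_ j)]; rewrite eqxx.
have gM j x : x \in M j -> g x = h j x.
  move=> xM; rewrite /g; case: pickP => [q /eqP xr|_].
    by have := disjoint_notin (MA j) xM; rewrite xr rA.
  case: pickP => [q xq|/(_ j)]; last by rewrite xM.
  have [->//|jq] := eqVneq j q.
  by have := disjoint_notin (Mdis _ _ jq) xM; rewrite xq.
have hA j x : x \in M j -> h j x \notin A.
  by move=> /(h_P j).2; apply: disjoint_notin.
have [|f fg] := @extend_injection T D g.
  move=> x y; rewrite !inE => /existsP[j /orP[/eqP ->|xj]] /existsP[q /orP[/eqP ->|yq]].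
  - by rewrite !gr => /r_inj/perm_inj ->.
  - by rewrite gr (gM _ _ yq) => e; have := hA _ _ yq; rewrite -e rA.
  - by rewrite gr (gM _ _ xj) => e; have := hA _ _ xj; rewrite e rA.
  - rewrite (gM _ _ xj) (gM _ _ yq) => e.
    have [jq|jq] := eqVneq j q.
      by rewrite -jq in yq e; apply: (h_P j).1.
    have sjq : s j != s q by rewrite (inj_eq perm_inj).
    have := disjoint_notin (Mdis' _ _ sjq) ((h_P j).2 _ xj).
    by rewrite e (h_P q).2.
apply: (@isomorphic_to_subgraph _ _ _ f) => x y xy.
wlog xA : x y xy / x \in A.
  move=> wl; have [|xA] := boolP (x \in A); first exact: wl.
  rewrite adj_sym wl 1?adj_sym //.
  by have := hub_graph_bipartite hM xy; rewrite (negbTE xA) => /esym/negbFE.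
have [j xr yM] := hub_graph_adjP y hM xA xy.
have xD : x \in D by rewrite inE; apply/existsP; exists j; rewrite xr eqxx.
have yD : y \in D by rewrite inE; apply/existsP; exists j; rewrite yM orbT.
by rewrite !fg // xr gr (gM _ _ yM) (hub_graph_adjl _ _ hM') (h_P j).2.
Qed.

(** * Sorted degrees and construction of the decomposition *)

Lemma sorted_rows n (T : finType) (G : sgraph T) (A : {set T}) : 0 < n ->
  (forall i, i < #|A| -> n - i <= nth 0 (degree_seq G A) (#|A| - i).-1) ->
  \sum_(a in A) degree G a = 'C(n.+1, 2) ->
  exists k, exists r : 'I_k -> T, [/\ k <= n /\ injective r, forall j, r j \in A,
    forall j : 'I_k, n - j <= degree G (r j), \sum_j degree G (r j) = 'C(n.+1, 2)
    & forall a, a \in A -> 0 < degree G a -> exists j, a = r j].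
Proof.
move=> n_gt0 hdeg hsum; have [A0|[x0 _]] := set_0Vmem A.
  by move: hsum; rewrite A0 big_set0 binS bin1; lia.
pose s := sort (relpre (degree G) leq) (enum A).
have s_size : size s = #|A| by rewrite size_sort cardE.
have s_uniq : uniq s by rewrite sort_uniq enum_uniq.
have s_mem a : (a \in s) = (a \in A) by rewrite mem_sort mem_enum.
(* [s] is sorted by nondecreasing degree, so [row i] has the [i]-th largest degree, counted from
   0. *)
pose row i := nth x0 s (#|A| - i).-1.
have row_ge i : i < #|A| -> n - i <= degree G (row i).
  move=> iA; have := hdeg i iA; rewrite /degree_seq sort_map (nth_map x0) //.
  by rewrite -/s s_size; lia.
have row_mem i : i < #|A| -> row i \in A.
  by move=> iA; rewrite -s_mem mem_nth // s_size; lia.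
have row_inj i j : i < #|A| -> j < #|A| -> row i = row j -> i = j.
  by move=> iA jA /eqP; rewrite nth_uniq ?s_size //; lia.
have row_sum : \sum_(i < #|A|) degree G (row i) = 'C(n.+1, 2).
  rewrite -hsum -[RHS]big_enum [RHS](perm_big s) /=; last by rewrite perm_sym perm_sort.
  rewrite (big_nth x0) big_mkord s_size [RHS](reindex_inj rev_ord_inj) /=.
  by apply: eq_bigr => i _; rewrite /row subnS.
have row_surj a : a \in A -> exists2 i, i < #|A| & a = row i.
  rewrite -s_mem => aS; have := aS; rewrite -index_mem s_size => lt_a.
  exists (#|A| - (index a s).+1); first lia.
  rewrite /row (_ : (_ - _).-1 = index a s) ?nth_index //; lia.
pose k := minn #|A| n; have kA : k <= #|A| by apply: geq_minl.
have [d dE] : exists d, #|A| = k + d by exists (#|A| - k); lia.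
have row_split : \sum_(i < k) degree G (row i)
    + \sum_(i < d) degree G (row (k + i)) = 'C(n.+1, 2).
  rewrite -row_sum; move: (fun i => degree G (row i)) => F.
  by rewrite [in RHS]dE big_split_ord.
have tail0 : \sum_(i < d) degree G (row (k + i)) = 0.
  case: (leqP #|A| n) => An.
    have -> : d = 0 by move: dE; rewrite /k; lia.
    by rewrite big_ord0.
  (* The bounds on the first [n] rows already add up to the whole degree sum. *)
  suff : 'C(n.+1, 2) <= \sum_(i < k) degree G (row i) by lia.
  have kE : k = n by rewrite /k; lia.
  rewrite -(sum_staircase (leqnn n)) subnn addn0 kE.
  by apply: leq_sum => i _; apply: row_ge; apply: ltn_trans (ltn_ord i) An.
exists k, (fun i : 'I_k => row i); split=> [|j|j||a aA a_deg].
- split; first exact: geq_minr.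
  move=> i j /row_inj ij; apply: val_inj; apply: ij; exact: leq_trans (ltn_ord _) kA.
- by apply: row_mem; apply: leq_trans (ltn_ord _) kA.
- by apply: row_ge; apply: leq_trans (ltn_ord _) kA.
- by rewrite -row_split tail0 addn0.
- have [i iA a_row] := row_surj a aA; case: (ltnP i k) => ik.
    by exists (Ordinal ik).
  have id : i - k < d by lia.
  move: tail0; rewrite (bigD1 (Ordinal id)) //= subnKC // -a_row; lia.
Qed.

Theorem theorem1 (n : nat) (hn : 1 <= n) (T : finType) (G : sgraph T)
  (hE : #|edges G| = 'C(n.+1, 2))
  (A B : {set T}) (hAB : colour_classes G A B)
  (hdeg : forall i, i < #|A| ->
     n - i <= nth 0 (degree_seq G A) (#|A| - i).-1) :
  exists F : nat -> sgraph T, star_forest_ASD G n F.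
Proof.
have bip x y : adj G x y -> (x \in A) = (y \notin A).
  case: hAB => AB dAB stA stB xy.
  have [xA|xA] := boolP (x \in A); have [yA|yA] := boolP (y \in A) => //.
    by have := stA x y xA yA; rewrite xy.
  have inB z : z \notin A -> z \in B.
    by move=> zA; have := in_setT z; rewrite -AB inE (negbTE zA).
  by have := stB x y (inB x xA) (inB y yA); rewrite xy.
have hsum : \sum_(a in A) degree G a = 'C(n.+1, 2).
  by rewrite -(card_edges_bipartite bip).
have [k [r [[kn r_inj] rA r_deg r_sum r_surj]]] := sorted_rows hn hdeg hsum.
have [dem [dem_row dem_col dem_hall dem_mono]] := star_levels kn r_deg r_sum.
(* The neighbourhood of each centre [r j] is partitioned into its leaf sets [M i j] over the levels
   [i]. *)
have [M [Mdem Mdis MN Mlev]] :=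
  @peel_levels k T n (fun j => [set b | adj G (r j) b]) dem dem_row dem_hall.
have MG i j y : i < n -> y \in M i j -> adj G (r j) y.
  move=> ni yM; have := MN j y; rewrite inE => ->.
  by apply/existsP; exists (Ordinal ni).
have hM i : i < n -> hub_family A r (M i).
  move=> ni; split=> // [j|]; last exact: Mdis.
  rewrite disjoints_subset; apply/subsetP => y /(MG _ _ _ ni)/bip.
  by rewrite rA inE.
(* Levels are counted from 0 and parts from 1, hence [i.-1]. *)
pose F i := hub_graph r (M i.-1).
have FG i x y : i < n -> adj (F i.+1) x y -> adj G x y.
  move=> ni; have hMi := hM i ni; move=> xy.
  have [xA|xA] := boolP (x \in A).
    by have [j -> yM] := hub_graph_adjP y hMi xA xy; apply: (MG i).
  have yA : y \in A.
    by have := hub_graph_bipartite hMi xy; rewrite (negbTE xA) => /esym/negbFE.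
  rewrite adj_sym in xy; rewrite adj_sym.
  by have [j -> xM] := hub_graph_adjP x hMi yA xy; apply: (MG i).
have GF x y : adj G x y -> exists2 i, i < n & adj (F i.+1) x y.
  wlog xA : x y / x \in A.
    move=> wl xy; have [xA|xA] := boolP (x \in A); first exact: wl.
    have yA : y \in A by have := bip _ _ xy; rewrite (negbTE xA) => /esym/negbFE.
    rewrite adj_sym in xy; have [i ni yx] := wl _ _ yA xy.
    by exists i => //; rewrite adj_sym.
  move=> xy; have [|j xr] := r_surj x xA.
    by rewrite card_gt0; apply/set0Pn; exists y; rewrite inE.
  have : y \in [set b | adj G (r j) b] by rewrite inE -xr.
  rewrite MN => /existsP[i yM]; exists i => //.
  by rewrite xr (hub_graph_adjl _ _ (hM i (ltn_ord i))).
exists F; split; last first.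
  by case=> [//|i] /andP[_ ni]; apply: hub_graph_star_forest (hM i ni).
split.
- rewrite big_add1 big_mkord; apply/setP => e.
  apply/bigcupP/edgesP => [[i _ /edgesP[x [y [xy ->]]]]|[x [y [/GF[i ni xy] ->]]]].
    by exists x, y; split=> //; apply: FG xy.
  by exists (Ordinal ni) => //; rewrite mem_edges.
- case=> [//|i] [//|l] /andP[_ ni] /andP[_ nl] il.
  rewrite disjoints_subset; apply/subsetP => e /edgesP[x [y [xy ->]]].
  rewrite inE mem_edges.
  wlog xA : x y xy / x \in A.
    move=> wl; have [|xA] := boolP (x \in A); first exact: wl.
    have yA : y \in A.
      by have := hub_graph_bipartite (hM i ni) xy; rewrite (negbTE xA) => /esym/negbFE.
    by rewrite adj_sym; apply: wl => //; rewrite adj_sym.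
  have [j xr yM] := hub_graph_adjP y (hM i ni) xA xy.
  rewrite xr (hub_graph_adjl _ _ (hM l nl)).
  exact: disjoint_notin (Mlev i l ni nl il j) yM.
- case=> [//|i] /andP[_ ni]; rewrite (card_edges_hub_graph (hM i ni)) /=.
  by rewrite -(dem_col i ni); apply: eq_bigr => j _; apply: Mdem.
- case=> [//|i] /andP[_ ni]; have [s le_s] := dem_mono i ni.
  apply: (hub_graph_embedding (A := A) (s := s)) => [||j]; try exact: hM.
    by apply: hM; apply: ltnW.
  by rewrite /= !Mdem //; apply: ltnW.
Qed.
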